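(* For each $r\in\mathbb{N}$ there exist polynomials $P_r(n), \overline{P}_r(n), Q_r(n), \overline{Q}_r(n)$ of degree $r$ with integer coefficients such that, for all positive integers $n$, \begin{align*} U_{2r+1}(2n) &= nP_r(n)\binom{2n}{n},\\ U_{2r+1}(2n-1) &= 2^{-(2r+1)}n\overline{P}_r(n)\binom{2n}{n},\\ U_{2r}(2n) &= 2^{2n-r}Q_r(n),\\ U_{2r}(2n+1) &= 2^{2n+1-2r}\overline{Q}_r(n). \end{align*} These polynomials satisfy the recurrences \begin{align*} P_{r+1}(n) &= n^2 P_r(n) -n(n-1)P_r(n-1),\\ \overline{P}_{r+1}(n) &= (2n-1)^2\,\overline{P}_r(n) - 4(n-1)^2\,\overline{P}_r(n-1),\\ Q_{r+1}(n) &= 2n^2 Q_r(n) - n(2n-1)Q_r(n-1),\\ \overline{Q}_{r+1}(n) &= (2n+1)^2\,\overline{Q}_r(n) - 2n(2n+1)\overline{Q}_r(n-1), \end{align*} with initial conditions $P_0(n) = \overline{P}_0(n) = Q_0(n) = \overline{Q}_0(n) = 1$.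
   Context: $\mathbb{N}$ denotes the non-negative integers. For $r\in\mathbb{N}$ and $n\in\mathbb{Z}$ define \[ U_r(n) = \sum_{k\in\mathbb{Z}} \binom{n}{k}\left|\frac{n}{2}-k\right|^r, \] where $0^0$ is interpreted as $1$, and for $n\in\mathbb{N}$ the binomial coefficient $\binom{n}{k}$ is $0$ if $k<0$ or $k>n$ and $\frac{n!}{(n-k)!\,k!}$ otherwise; $U_r(n)=0$ for $n<0$. *)

(* Defs.v *)
From mathcomp Require Import all_boot all_order all_algebra finmap.
From mathcomp Require Import boolp classical_sets functions cardinality fsbigop.

Set Implicit Arguments.
Unset Strict Implicit.
Unset Printing Implicit Defensive.

Import Order.TTheory GRing.Theory Num.Theory.
Local Open Scope classical_set_scope.
Local Open Scope ring_scope.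

(* A negative top argument also gives 0, which makes [U r n] vanish for n < 0. *)
Definition binz (n k : int) : nat :=
  match n, k with
  | Posz m, Posz j => 'C(m, j)
  | _, _ => 0
  end.

(* [0 ^+ 0 = 1] in MathComp, as required when r = 0. The sum over int is
   MathComp's finitely supported sum, equal to 0 by default on an infinite
   support; the support is finite here, see [U_nat]. *)
Definition U (r : nat) (n : int) : rat :=
  \sum_(k \in [set: int]) (binz n k)%:R * `|n%:~R / 2 - k%:~R : rat| ^+ r.

Lemma U_nat (r m : nat) :
  U r m%:Z =
  \sum_(k < m.+1) 'C(m, k)%:R * `|m%:R / 2 - k%:R : rat| ^+ r.
Proof.
rewrite /U (fsbigE [seq k%:Z | k <- iota 0 m.+1]) //.
- rewrite big_map -(big_mkord xpredT (fun k => 'C(m, k)%:R *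
    `|m%:R / 2 - k%:R : rat| ^+ r)) /index_iota subn0.
  by apply: eq_bigl => k; rewrite in_setT.
- by rewrite map_inj_uniq ?iota_uniq // => x y [].
- case=> k _; last by rewrite mul0r.
  case: (leqP k m) => [lekm|ltmk _]; last by rewrite /= bin_small // mul0r.
  by rewrite map_f // mem_iota /= add0n ltnS.
Qed.

Lemma U_neg (r m : nat) : U r (Negz m) = 0.
Proof. by rewrite /U fsbig1 // => k _; rewrite mul0r. Qed.

(* Main.v *)
(* Since (n/2 - k)^2 = n^2/4 - k(n - k) and C(n,k) k (n - k) = n (n-1) C(n-2,k-1),
   while n/2 - k = (n-2)/2 - (k-1), one gets
     U_{r+2}(n) = n^2/4 U_r(n) - n (n-1) U_r(n-2).
   This is the recurrence of each of the four polynomial families, so the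
   formulas follow by induction on r from U_0 and U_1. The sum U_1 telescopes,
   as the sum over k < j of C(n,k) (n - 2k) is j C(n,j). For the degrees,
   p(x) - p(x-1) drops the degree by one and multiplies the leading coefficient
   by the degree, so the leading coefficients remain positive. *)
Require Import Defs.
From mathcomp Require Import all_boot all_order all_algebra.
From mathcomp Require Import zify ring lra.

Import Order.TTheory GRing.Theory Num.Theory.
Local Open Scope ring_scope.

(** * Degree and leading coefficient under the backward difference *)

Lemma coef_sub_comp_shift (p : {poly int}) (n : nat) :
  (size p <= n.+1)%N ->
  let d := p - (p \Po ('X - 1)) in
  (size d <= n)%N /\ d`_n.-1 = p`_n *+ n.
Proof.
elim/poly_ind: p n => [|p c IHp] n /=.
  by rewrite comp_poly0 subr0 size_poly0 !coef0 mul0rn.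
rewrite comp_polyD comp_polyM comp_polyX comp_polyC => sz_pc.
case: n sz_pc => [|n] sz_pc.
  have p0 : p = 0.
    apply/eqP; rewrite -size_poly_eq0; move: sz_pc; rewrite size_MXaddC.
    by case: eqP => [->|_]; rewrite ?size_poly0 //=; case: (size p).
  by rewrite p0 comp_poly0 !mul0r !add0r subrr size_poly0 coef0 mulr0n.
have sz_p : (size p <= n.+1)%N.
  move: sz_pc; rewrite size_MXaddC.
  by case: ifP => [/andP[/eqP -> _]|_]; rewrite ?size_poly0.
have [sz_d d_n] := IHp n sz_p; set d := p - _ in sz_d d_n.
(* Here [p - d] is the shifted polynomial p(X - 1), so the new difference is X times the old one
   plus a term that adds one more copy of the leading coefficient. *)
have -> : p * 'X + c%:P - ((p \Po ('X - 1)) * ('X - 1) + c%:P)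
    = d * 'X + (p - d) by rewrite /d; ring.
have d_0 : d`_n = 0 by rewrite nth_default.
clearbody d.
split.
  apply: leq_trans (size_polyD _ _) _; rewrite geq_max; apply/andP; split.
    by apply: leq_trans (size_polyMleq _ _) _; rewrite size_polyX addn2.
  by apply: leq_trans (size_polyD _ _) _; rewrite geq_max size_polyN sz_p leqW.
rewrite !(coefD, coefN, coefMX, coefC) /= d_0 oppr0 !addr0 mulrSr; congr (_ + _).
by case: n d_n {sz_p sz_d d_0 sz_pc} => [|n] //= _; rewrite mulr0n.
Qed.

(** The quadratic terms of [A] and [B] cancel, so the degree rises by one only: the new leading
    coefficient is (a n + l + 1) times that of [p]. Taking [a] and [l] in [nat] makes this factor
    positive. *)
Lemma size_shift_step (a l : nat) (b c m : int) (A B p : {poly int}) (n : nat) :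
  A = a%:R * 'X^2 + b%:~R * 'X + c%:~R ->
  A - B = l.+1%:R * 'X + m%:~R ->
  size p = n.+1 -> 0 < p`_n ->
  let q := A * p - B * (p \Po ('X - 1)) in
  size q = n.+2 /\ 0 < q`_n.+1.
Proof.
move=> eA eAB sz_p p_n q.
have [] := coef_sub_comp_shift p n; first by rewrite sz_p.
set d := p - _ => sz_d d_n.
have d0 i : (n <= i)%N -> d`_i = 0 by move=> le_ni; rewrite nth_default ?(leq_trans sz_d).
have p0 i : (n < i)%N -> p`_i = 0 by move=> lt_ni; rewrite nth_default ?sz_p.
have eq_q : q = (a%:R)%:P * (d * 'X^2) + b%:P * (d * 'X) + c%:P * d
    + ((l.+1%:R)%:P * ((p - d) * 'X) + m%:P * (p - d)).
  (* Both products have degree at most n + 1, as [d] has degree below n and [A - B] is linear. *)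
  have -> : q = A * d + (A - B) * (p - d) by rewrite /q /d; ring.
  have polyC_int (z : int) : z%:P = z%:~R by rewrite -{1}[z]intz rmorph_int.
  rewrite eAB eA !rmorph_nat !polyC_int; clearbody d.
  by ring.
clearbody d q.
have q_n i : q`_i = a%:R * (if (i < 2)%N then 0 else d`_(i - 2))
    + b * (if i == 0%N then 0 else d`_i.-1) + c * d`_i
    + (l.+1%:R * (if i == 0%N then 0 else p`_i.-1 - d`_i.-1) + m * (p`_i - d`_i)).
  by rewrite eq_q !coefD !coefCM coefMXn !coefMX !coefB.
have q_lead : 0 < q`_n.+1.
  rewrite q_n /= (d0 n) // (d0 n.+1) // (p0 n.+1) //.
  have -> : (if (n.+1 < 2)%N then 0 else d`_(n.+1 - 2)) = p`_n *+ n.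
    (* For n = 0 the index [n.-1] is 0, and [d] is zero there. *)
    by rewrite -d_n; case: (n) d0 => [|k] d0 //=; [rewrite d0|rewrite subn2].
  rewrite subr0 !mulr0 !addr0 -[_ *+ n]mulr_natl ltr_wpDl ?mulr_gt0 //.
  by rewrite !mulr_ge0 // ltW.
split=> //; apply/eqP; rewrite eqn_leq; apply/andP; split.
  apply/leq_sizeP => -[|[|i]] // le_ni.
  by rewrite q_n /= subn2 /= !d0 ?p0 ?mulr0 ?subr0 ?mulr0 ?addr0 //; lia.
by rewrite ltnNge; apply/negP => /leq_sizeP /(_ n.+1 (leqnn _)) q0; rewrite q0 ltxx in q_lead.
Qed.

(** * The four polynomial families as iterates of one operator *)

Definition shift_step (A B p : {poly int}) := A * p - B * (p \Po ('X - 1)).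

Definition polP (r : nat) := iter r (shift_step 'X^2 ('X * ('X - 1))) 1.
Definition polPbar (r : nat) :=
  iter r (shift_step ((2 * 'X - 1) ^+ 2) (4 * ('X - 1) ^+ 2)) 1.
Definition polQ (r : nat) := iter r (shift_step (2 * 'X^2) ('X * (2 * 'X - 1))) 1.
Definition polQbar (r : nat) :=
  iter r (shift_step ((2 * 'X + 1) ^+ 2) (2 * 'X * (2 * 'X + 1))) 1.

Lemma size_iter_step (A B : {poly int}) (a l : nat) (b c m : int) (r : nat) :
  A = a%:R * 'X^2 + b%:~R * 'X + c%:~R ->
  A - B = l.+1%:R * 'X + m%:~R ->
  size (iter r (shift_step A B) 1) = r.+1.
Proof.
move=> eA eAB.
(* Positivity of the leading coefficient has to be carried through the induction to exclude
   cancellation. *)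
suff [] : size (iter r (shift_step A B) 1) = r.+1
  /\ 0 < (iter r (shift_step A B) 1)`_r by [].
elim: r => [|r [sz_p p_r]] /=; first by rewrite size_poly1 coef1.
exact: size_shift_step eA eAB sz_p p_r.
Qed.

Lemma horner_shift_step (A B p : {poly int}) (x : int) :
  (shift_step A B p).[x]%:~R
  = A.[x]%:~R * p.[x]%:~R - B.[x]%:~R * p.[x - 1]%:~R :> rat.
Proof.
by rewrite /shift_step hornerD hornerN !hornerM horner_comp !hornerE rmorphB !rmorphM.
Qed.

(** * The recurrence for [U] in steps of two *)

Lemma mul_bin_inner (m k : nat) :
  (k.+1 * (m.+1 - k) * 'C(m.+2, k.+1) = m.+2 * m.+1 * 'C(m, k))%N.
Proof.
by rewrite mulnAC -mul_bin_diag mulnAC -mulnA -mul_bin_down; ring.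
Qed.

Lemma U_step (r m : nat) :
  U r.+2 m%:Z = m%:R ^+ 2 / 4 * U r m%:Z - (m * m.-1)%:R * U r m.-2%:Z.
Proof.
(* For m = 0 and m = 1 the truncated [m.-2] is harmless, because its coefficient m (m - 1)
   vanishes. *)
case: m => [|[|m]].
- rewrite !U_nat !big_ord_recl !big_ord0 /= mul0r subrr normr0 -[r.+2]addn2 exprD.
  by field.
- rewrite !U_nat !big_ord_recl !big_ord0 /= -[r.+2]addn2 !exprD.
  by rewrite !real_normK ?num_real //; field.
rewrite !U_nat /=.
have term (k : 'I_m.+3) : true ->
    'C(m.+2, k)%:R * `|m.+2%:R / 2 - k%:R : rat| ^+ r.+2
    = m.+2%:R ^+ 2 / 4 * ('C(m.+2, k)%:R * `|m.+2%:R / 2 - k%:R| ^+ r)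
      - (k * (m.+2 - k) * 'C(m.+2, k))%:R * `|m.+2%:R / 2 - k%:R| ^+ r.
  move=> _; have lek : (k <= m.+2)%N by rewrite -ltnS.
  rewrite -[r.+2]addn2 exprD real_normK ?num_real // !natrM natrB //.
  by field.
rewrite (eq_bigr _ term) big_split /= -mulr_sumr sumrN; congr (_ - _).
(* The two end terms vanish through the factor k (m + 2 - k); the rest is reindexed by k + 1. *)
rewrite big_ord_recl /= !mul0n mul0r add0r big_ord_recr /=.
rewrite subnn muln0 mul0n mul0r addr0 mulr_sumr; apply: eq_bigr => k _.
rewrite /bump /= add1n subSS mul_bin_inner natrM -mulrA; congr (_ * (_ * `|_| ^+ _)).
by rewrite -!natr1; field.
Qed.

(** * The base cases [U 0] and [U 1] *)

Lemma U0 (m : nat) : U 0 m%:Z = 2 ^+ m.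
Proof.
rewrite U_nat; under eq_bigr => k _ do rewrite expr0 mulr1.
rewrite -natr_sum -natrX; congr (_%:R).
rewrite -[2%N]/(1 + 1)%N expnDn; apply: eq_bigr => k _.
by rewrite !exp1n !muln1.
Qed.

Lemma sum_bin_centered (m j : nat) :
  \sum_(0 <= k < j) 'C(m, k)%:R * (m%:R / 2 - k%:R) = j%:R / 2 * 'C(m, j)%:R :> rat.
Proof.
elim: j => [|j IHj]; first by rewrite big_geq // !mul0r.
rewrite big_nat_recr //= IHj.
(* Beyond [m] all the binomials involved are zero. *)
have [ltmj|lejm] := ltnP m j.
  by rewrite !bin_small ?(leqW ltmj) // !mulr0 mul0r addr0.
have := congr1 (fun x : nat => x%:R : rat) (mul_bin_left m j).
rewrite /= !natrM natrB // => e.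
transitivity ((j.+1%:R * 'C(m, j.+1)%:R) / 2 : rat); last by field.
by rewrite e; field.
Qed.

(** The hypotheses place the cut [j] at the centre: m/2 - k is nonnegative for k < j and nonpositive
    from [j] on. The full signed sum is zero, so the sum of absolute values is twice the part below
    [j]. *)
Lemma U1 (m j : nat) : (2 * j <= m.+2)%N -> (m <= 2 * j)%N ->
  U 1 m%:Z = j%:R * 'C(m, j)%:R.
Proof.
move=> lejm lemj; rewrite U_nat.
rewrite -(big_mkord xpredT (fun k => 'C(m, k)%:R * `|m%:R / 2 - k%:R : rat| ^+ 1)).
have lej : (j <= m.+1)%N by lia.
have := sum_bin_centered m m.+1; rewrite bin_small // mulr0.
rewrite !(big_cat_nat (leq0n j) lej) /= sum_bin_centered => tot.
have -> : \sum_(0 <= k < j) 'C(m, k)%:R * `|m%:R / 2 - k%:R : rat| ^+ 1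
    = \sum_(0 <= k < j) 'C(m, k)%:R * (m%:R / 2 - k%:R).
  apply: eq_big_nat => k /andP[_ ltkj]; rewrite expr1 ger0_norm //.
  have : (2 * k)%:R <= m%:R :> rat by rewrite ler_nat; lia.
  by rewrite natrM; lra.
have -> : \sum_(j <= k < m.+1) 'C(m, k)%:R * `|m%:R / 2 - k%:R : rat| ^+ 1
    = - \sum_(j <= k < m.+1) 'C(m, k)%:R * (m%:R / 2 - k%:R).
  rewrite -sumrN; apply: eq_big_nat => k /andP[lejk _].
  rewrite expr1 ler0_norm ?mulrN //.
  have : m%:R <= (2 * k)%:R :> rat by rewrite ler_nat; lia.
  by rewrite natrM; lra.
rewrite sum_bin_centered; set x := _ * _ in tot *; set y := (j%:R * _).
have : x = y / 2 by rewrite /x /y; field.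
lra.
Qed.

(** This is [mul_bin_inner] at the centre, with one factor n + 1 cancelled. *)
Lemma mul_bin_central (n : nat) :
  (n.+1 * 'C(2 * n.+1, n.+1) = 2 * (2 * n).+1 * 'C(2 * n, n))%N.
Proof.
have := mul_bin_inner (2 * n) n.
have -> : ((2 * n).+1 - n = n.+1)%N by lia.
rewrite (mulnS 2 n) => e; apply/eqP; rewrite -(eqn_pmul2l (ltn0Sn n)) mulnA e; apply/eqP; ring.
Qed.

Lemma bin_central_rat (n : nat) :
  'C(2 * n.+1, n.+1)%:R
  = 2 * (2 * n%:R + 1) * 'C(2 * n, n)%:R / (n%:R + 1) :> rat.
Proof.
have n1 : n%:R + 1 != 0 :> rat by rewrite natr1 pnatr_eq0.
apply: (mulfI n1); rewrite [in LHS]natr1 -(natrM _ n.+1) mul_bin_central !natrM -!natr1 natrM.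
by field.
Qed.

(** * The four closed forms, by induction on [r] with [n] general since the recurrence also calls n
    - 1 *)

Definition horner_opsE := (hornerD, hornerN, hornerM, hornerXn, horner_exp, hornerMn, hornerX, hornerC).

Lemma U_zero (r : nat) : U r.+1 0%:Z = 0.
Proof. by rewrite U_nat big_ord1 mul0r subrr normr0 expr0n mulr0. Qed.

Lemma U_odd_even (r n : nat) :
  U (2 * r + 1)%N (2 * n)%N%:Z
  = n%:R * (polP r).[n%:Z]%:~R * 'C(2 * n, n)%:R.
Proof.
elim: r n => [|r IHr] n.
  by rewrite (U1 (2 * n) n) /polP /= ?hornerC ?mulr1 //; lia.
case: n => [|n]; first by rewrite muln0 mul0r mul0r addn1 U_zero.
rewrite (_ : 2 * r.+1 + 1 = (2 * r + 1).+2)%N; last by lia.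
rewrite U_step (_ : (2 * n.+1).-2 = 2 * n)%N; last by lia.
rewrite (_ : (2 * n.+1).-1 = (2 * n).+1)%N; last by lia.
rewrite !IHr /polP iterS -/(polP r) horner_shift_step.
rewrite (_ : n.+1%:Z - 1 = n%:Z); last by lia.
have -> : ('X^2 : {poly int}).[n.+1%:Z]%:~R = (n%:R + 1) ^+ 2 :> rat.
  by rewrite !horner_opsE; ring.
have -> : ('X * ('X - 1) : {poly int}).[n.+1%:Z]%:~R = (n%:R + 1) * n%:R :> rat.
  by rewrite !horner_opsE; ring.
rewrite bin_central_rat !natrM -!natr1 natrM.
by field; rewrite natr1 pnatr_eq0.
Qed.

Lemma U_odd_odd (r n : nat) :
  U (2 * r + 1)%N (2 * n).+1%:Z
  = 2 ^- (2 * r + 1) * n.+1%:R * (polPbar r).[n.+1%:Z]%:~R * 'C(2 * n.+1, n.+1)%:R.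
Proof.
have n1 k : k%:R + 1 != 0 :> rat by rewrite natr1 pnatr_eq0.
elim: r n => [|r IHr] n.
  rewrite (U1 (2 * n).+1 n.+1) /polPbar /= ?hornerC ?mulr1; try lia.
  (* The central binomial is twice its neighbour in the row above; this factor 2 cancels the
     prefactor 1/2. *)
  have e : (n.+1 * 'C(2 * n.+1, n.+1) = 2 * (n.+1 * 'C((2 * n).+1, n.+1)))%N.
    have := mul_bin_down (2 * n.+1) n.+1.
    rewrite (_ : 2 * n.+1 - n.+1 = n.+1)%N; last by lia.
    by rewrite (_ : (2 * n.+1).-1 = (2 * n).+1)%N; [move=> <-; ring | lia].
  by rewrite -!mulrA -!natrM e natrM; field.
rewrite (_ : 2 * r.+1 + 1 = (2 * r + 1).+2)%N; last by lia.
rewrite U_step IHr /polPbar iterS -/(polPbar r) horner_shift_step.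
rewrite (_ : n.+1%:Z - 1 = n%:Z); last by lia.
have -> : ((2 * 'X - 1) ^+ 2 : {poly int}).[n.+1%:Z]%:~R = (2 * n%:R + 1) ^+ 2 :> rat.
  by rewrite !horner_opsE; ring.
have -> : (4 * ('X - 1) ^+ 2 : {poly int}).[n.+1%:Z]%:~R = 4 * n%:R ^+ 2 :> rat.
  by rewrite !horner_opsE; ring.
rewrite -[in RHS](addn2 (2 * r + 1)) (exprD _ (2 * r + 1) 2).
(* The lower term is brought to the same central binomial. At n = 0 the induction hypothesis does
   not reach it, but both sides are zero. *)
have -> : ((2 * n).+1 * (2 * n).+1.-1)%:R * U (2 * r + 1) (2 * n).+1.-2%:Z
    = n%:R ^+ 2 * (2 ^- (2 * r + 1) * n.+1%:R * (polPbar r).[n%:Z]%:~R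
                                    * 'C(2 * n.+1, n.+1)%:R).
  case: n => [|n]; first by rewrite muln0 !mul0r.
  rewrite (_ : (2 * n.+1).+1.-2 = (2 * n).+1)%N; last by lia.
  rewrite IHr [in RHS]bin_central_rat /= natrM -(natr1 (2 * n.+1)) natrM.
  rewrite -(natr1 n.+1); field.
  by rewrite nat1r n1 expf_neq0.
rewrite -(natr1 (2 * n)) natrM.
by field; rewrite expf_neq0.
Qed.

Lemma U_even_even (r n : nat) :
  U (2 * r)%N (2 * n)%N%:Z = 2 ^+ (2 * n) * 2 ^- r * (polQ r).[n%:Z]%:~R.
Proof.
elim: r n => [|r IHr] n.
  by rewrite muln0 U0 /polQ /= hornerC invr1 !mulr1.
rewrite (_ : 2 * r.+1 = (2 * r).+2)%N; last by lia.
rewrite U_step IHr /polQ iterS -/(polQ r) horner_shift_step.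
have -> : (2 * 'X^2 : {poly int}).[n%:Z]%:~R = 2 * n%:R ^+ 2 :> rat.
  by rewrite !horner_opsE; ring.
have -> : ('X * (2 * 'X - 1) : {poly int}).[n%:Z]%:~R = n%:R * (2 * n%:R - 1) :> rat.
  by rewrite !horner_opsE; ring.
case: n => [|n].
  by rewrite muln0 !mul0r !subrr mulr0.
rewrite (_ : (2 * n.+1).-2 = 2 * n)%N; last by lia.
rewrite (_ : (2 * n.+1).-1 = (2 * n).+1)%N; last by lia.
rewrite (_ : n.+1%:Z - 1 = n%:Z); last by lia.
rewrite IHr mulnS exprD (exprS _ r) natrM natrD -(natr1 (2 * n)) -(natr1 n) natrM.
by field; rewrite expf_neq0.
Qed.

Lemma U_even_odd (r n : nat) :
  U (2 * r)%N (2 * n).+1%:Z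
  = 2 ^+ (2 * n).+1 * 2 ^- (2 * r) * (polQbar r).[n%:Z]%:~R.
Proof.
elim: r n => [|r IHr] n.
  by rewrite muln0 U0 /polQbar /= hornerC invr1 !mulr1.
rewrite (_ : 2 * r.+1 = (2 * r).+2)%N; last by lia.
rewrite U_step IHr /polQbar iterS -/(polQbar r) horner_shift_step.
have -> : ((2 * 'X + 1) ^+ 2 : {poly int}).[n%:Z]%:~R = (2 * n%:R + 1) ^+ 2 :> rat.
  by rewrite !horner_opsE; ring.
have -> : (2 * 'X * (2 * 'X + 1) : {poly int}).[n%:Z]%:~R
    = 2 * n%:R * (2 * n%:R + 1) :> rat.
  by rewrite !horner_opsE; ring.
(* At n = 0 the lower term drops out on both sides, so only the square term remains. *)
case: n => [|n].
  rewrite muln0 /= muln0 mul0r -[(2 * r).+2]addn2 exprD.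
  by field; rewrite expf_neq0.
rewrite (_ : (2 * n.+1).+1.-2 = (2 * n).+1)%N; last by lia.
rewrite (_ : n.+1%:Z - 1 = n%:Z); last by lia.
rewrite IHr (mulnS 2 n) /= natrM -(natr1 (2 + 2 * n)) natrD -(natr1 n) natrM.
rewrite -[(2 * r).+2]addn2 -[(2 + 2 * n).+1]addn1 -[(2 * n).+1]addn1 !exprD.
by field; rewrite expf_neq0.
Qed.

Theorem theorem2 :
  exists P Pbar Q Qbar : nat -> {poly int},
    [/\ forall r : nat,
          [/\ size (P r) = r.+1, size (Pbar r) = r.+1,
              size (Q r) = r.+1 & size (Qbar r) = r.+1],
        forall (r n : nat), (0 < n)%N ->
          [/\ U (2 * r + 1)%N (2 * n%:Z)
              = n%:R * (P r).[n%:Z]%:~R * 'C(2 * n, n)%:R,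
              U (2 * r + 1)%N (2 * n%:Z - 1)
              = (2 : rat) ^ (- (2 * r%:Z + 1))
                * n%:R * (Pbar r).[n%:Z]%:~R * 'C(2 * n, n)%:R,
              U (2 * r)%N (2 * n%:Z)
              = (2 : rat) ^ (2 * n%:Z - r%:Z) * (Q r).[n%:Z]%:~R &
              U (2 * r)%N (2 * n%:Z + 1)
              = (2 : rat) ^ (2 * n%:Z + 1 - 2 * r%:Z) * (Qbar r).[n%:Z]%:~R],
        forall r : nat,
          [/\ P r.+1 = 'X^2 * P r - 'X * ('X - 1) * (P r \Po ('X - 1)),
              Pbar r.+1 = (2 * 'X - 1) ^+ 2 * Pbar r
                          - 4 * ('X - 1) ^+ 2 * (Pbar r \Po ('X - 1)),
              Q r.+1 = 2 * 'X^2 * Q r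
                       - 'X * (2 * 'X - 1) * (Q r \Po ('X - 1)) &
              Qbar r.+1 = (2 * 'X + 1) ^+ 2 * Qbar r
                          - 2 * 'X * (2 * 'X + 1) * (Qbar r \Po ('X - 1))] &
        [/\ P 0%N = 1, Pbar 0%N = 1, Q 0%N = 1 & Qbar 0%N = 1]].
Proof.
exists polP, polPbar, polQ, polQbar; split.
- move=> r; split.
  (* The arguments [a], [l], [b], [c], [m] come from expanding [A] and [A - B]; the latter is X, 4X
     - 3, X and 2X + 1 in the four cases. *)
  + by apply: (@size_iter_step _ _ 1 0 0 0 0); ring.
  + by apply: (@size_iter_step _ _ 4 3 (- 4) 1 (- 3)); ring.
  + by apply: (@size_iter_step _ _ 2 0 0 0 0); ring.
  + by apply: (@size_iter_step _ _ 4 1 4 1 1); ring.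
- move=> r n n_gt0.
  have e2n : 2 * n%:Z = (2 * n)%N%:Z by rewrite PoszM.
  split.
  + by rewrite e2n U_odd_even.
  (* Since n is positive, 2n - 1 is the odd number 2(n - 1) + 1 to which [U_odd_odd] applies. *)
  + case: n n_gt0 e2n => // n _ _.
    have -> : 2 * n.+1%:Z - 1 = (2 * n).+1%:Z by lia.
    have -> : - (2 * r%:Z + 1) = - (2 * r + 1)%N%:Z by lia.
    by rewrite U_odd_odd exprnN.
  + by rewrite e2n U_even_even expfzDr // exprnN.
  + have -> : 2 * n%:Z + 1 - 2 * r%:Z = (2 * n).+1%:Z - (2 * r)%N%:Z by lia.
    have -> : 2 * n%:Z + 1 = (2 * n).+1%:Z by lia.
    by rewrite U_even_odd expfzDr // exprnN.
- by [].
- by [].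
Qed.
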